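(* Let $\{u^n\}_{n\ge0}$ be a sequence generated by the forward-backward splitting iteration described in the context, and let $u^*$ be a minimizer of $F+\Phi$ over $X$. If $\Phi$ is totally convex in $u^*$, then $u^*$ is the unique minimizer of $F+\Phi$ and $\{u^n\}$ converges to $u^*$ strongly in $X$.
   Context: Setting. $X$ is a real reflexive Banach space with dual $X^*$ and duality pairing $\langle\cdot,\cdot\rangle$. $F:X\to\mathbb{R}$ and $\Phi:X\to\mathbb{R}\cup\{\infty\}$ are proper, convex and lower semi-continuous, and $F+\Phi$ is coercive, i.e. $(F+\Phi)(u)\to\infty$ as $\|u\|_X\to\infty$. $F$ is differentiable and, for some fixed $1<p\le 2$, its derivative $F':X\to X^*$ is $(p-1)$-Hölder-continuous on each bounded set: for each $R>0$ there is $L>0$ with $\|F'(u)-F'(v)\|_{X^*}\le L\|u-v\|_X^{p-1}$ whenever $\|u\|_X,\|v\|_X\le R$. Iteration. Fix $0<\delta<1$ and $\underline\tau>0$, and start with $u^0\in X$, $\Phi(u^0)<\infty$. Given $u^n$, let $L_n>0$ (denoted $\|F'\|_{p-1}$) be a $(p-1)$-Hölder constant of $F'$ on a ball $\{\|u\|_X\le C_n\}$ such that $\|u\|_X\le C_n$ for all $u$ with $(F+\Phi)(u)\le(F+\Phi)(u^n)$ (one may keep $L_{n}=L_{n-1}$). Set $w^n=F'(u^n)$, choose $\tau_n$ with $0<\underline\tau\le\tau_n\le p(1-\delta)/L_n$, and let $u^{n+1}$ be a solution of $$\min_{v\in X}\ \frac{\|v-u^n\|_X^p}{p}+\tau_n\bigl(\langle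 w^n,v\rangle+\Phi(v)\bigr)$$ which minimizes $\|v-u^n\|_X$ among all solutions $v$. (Stopping at an optimal iterate corresponds to the sequence staying constant from then on.) Definition. A proper, convex and lower semi-continuous $\Phi:X\to\mathbb{R}\cup\{\infty\}$ is totally convex in $u^*\in X$ if for each $w\in\partial\Phi(u^* )$ and each sequence $\{v^n\}$ in $X$: $\Phi(v^n)-\Phi(u^* )-\langle w,v^n-u^*\rangle\to0$ implies $\|v^n-u^*\|_X\to0$. *)

(* Defs.v *)
From HB Require Import structures.
From mathcomp Require Import all_boot all_order all_algebra.
From mathcomp Require Import all_classical all_reals all_analysis.

Set Implicit Arguments.
Unset Strict Implicit.
Unset Printing Implicit Defensive.

Import Order.TTheory GRing.Theory Num.Theory.
Import numFieldNormedType.Exports.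

Local Open Scope classical_set_scope.
Local Open Scope ring_scope.

Section Dual.
Context (R : realType) (X : normedModType R).

Definition cont_linear : {pred X -> R^o} :=
  mem [set f : X -> R^o | linear f /\ continuous f].

Record dual := Dual { functional :> X -> R^o ; _ : functional \in cont_linear }.

HB.instance Definition _ := [isSub for functional].
HB.instance Definition _ := [Choice of dual by <:].

Lemma cont_linear_submod_closed : submod_closed cont_linear.
Proof.
split.
  rewrite inE; split => [a x y|x]; last exact: cvg_cst.
  by rewrite /= scaler0 addr0.
move=> k f g; rewrite !inE => -[lf cf] [lg cg]; split.
  move=> a x y.
  have E z : (k *: f + g) z = k *: f z + g z :> R^o by [].
  by rewrite !E lf lg !scalerDr !scalerA [a * k]mulrC addrACA.
move=> x; apply: (@cvgD _ _ _ _ _ (k \*: f) g); last exact: cg.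
by apply: cvgZr; exact: cf.
Qed.

HB.instance Definition _ :=
  GRing.isSubmodClosed.Build _ _ cont_linear cont_linear_submod_closed.
HB.instance Definition _ := [SubChoice_isSubLmodule of dual by <:].

Lemma dual_linear (f : dual) : linear f.
Proof. by case: f => f /= /[!inE] -[]. Qed.

HB.instance Definition _ (f : dual) :=
  GRing.isLinear.Build R X R^o *:%R (functional f) (dual_linear f).

Lemma dual_continuous (f : dual) : continuous f.
Proof. by case: f => f /= /[!inE] -[]. Qed.

Definition dual_norm (f : dual) : R :=
  sup [set `|f x| | x in [set x : X | `|x| <= 1]].

Lemma dual_norm_has_sup (f : dual) :
  has_sup [set `|f x| | x in [set x : X | `|x| <= 1]].
Proof.
split; first by exists `|f 0|, 0 => //=; rewrite normr0.
have /bounded_funP/(_ 1)[M fM] :=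
  continuous_linear_bounded (0 : X) (@dual_continuous f 0).
by exists M => _ [x /= x1 <-]; exact: fM.
Qed.

Lemma dual_norm_unit (f : dual) x : `|x| <= 1 -> `|f x| <= dual_norm f.
Proof.
by move=> x1; apply: ub_le_sup; [exact: (dual_norm_has_sup f).2|exists x].
Qed.

Lemma dual_norm_ge0 (f : dual) : 0 <= dual_norm f.
Proof. by apply: le_trans (@dual_norm_unit f 0 _); rewrite ?normr0. Qed.

Lemma dual_norm_le (f : dual) M :
  (forall x, `|x| <= 1 -> `|f x| <= M) -> dual_norm f <= M.
Proof.
move=> fM; apply: ge_sup; first exact: (dual_norm_has_sup f).1.
by move=> _ [x /= x1 <-]; exact: fM.
Qed.

Lemma dual_normP (f : dual) x : `|f x| <= dual_norm f * `|x|.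
Proof.
have [->|x0] := eqVneq x 0; first by rewrite linear0 !normr0 mulr0.
rewrite -ler_pdivrMr ?normr_gt0//.
have /(@dual_norm_unit f) : `| `|x|^-1 *: x| <= 1 by rewrite normfZV.
by rewrite linearZ/= normrZ normfV normr_id mulrC.
Qed.

Lemma ler_dual_normD (f g : dual) : dual_norm (f + g) <= dual_norm f + dual_norm g.
Proof.
apply: dual_norm_le => x x1; rewrite [X in `|X|]/(f x + g x).
by apply: (le_trans (ler_normD _ _)); rewrite lerD// dual_norm_unit.
Qed.

Lemma dual_normZ (k : R) (f : dual) : dual_norm (k *: f) = `|k| * dual_norm f.
Proof.
apply/eqP; rewrite eq_le; apply/andP; split.
  apply: dual_norm_le => x x1; rewrite [X in `|X|]/(k * f x) normrM.
  by rewrite ler_wpM2l// dual_norm_unit.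
have [->|k0] := eqVneq k 0; first by rewrite normr0 mul0r dual_norm_ge0.
rewrite mulrC -ler_pdivlMr ?normr_gt0//; apply: dual_norm_le => x x1.
rewrite ler_pdivlMr ?normr_gt0// mulrC -normrM.
exact: (@dual_norm_unit (k *: f) x x1).
Qed.

Lemma dual_norm_eq0 (f : dual) : dual_norm f = 0 -> f = 0.
Proof.
move=> f0; apply: val_inj; apply/funext => x.
by apply/eqP; rewrite -normr_le0 (le_trans (dual_normP f x))// f0 mul0r.
Qed.

HB.instance Definition _ :=
  Lmodule_isNormed.Build R dual ler_dual_normD dual_normZ dual_norm_eq0.

End Dual.

Section Reflexive.
Context (R : realType) (X : normedModType R).

(* the canonical embedding of X into its bidual is onto *)
Definition reflexive_space : Prop :=
  forall phi : dual (dual X), exists x : X, forall f : dual X, phi f = f x.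

End Reflexive.

Section ConvexAnalysis.
Context (R : realType) (X : normedModType R).
Implicit Types (f : X -> \bar R) (u v : X).
Local Open Scope ereal_scope.

Definition proper f := (forall u, -oo < f u) /\ exists u, f u < +oo.

(* Meant for functions that never take the value -oo; at t = 0 or t = 1 the
   convention 0 * +oo = 0 keeps the inequality trivially true. *)
Definition econvex f := forall (t : R) u v, (0 <= t <= 1)%R ->
  f (t *: u + (1 - t) *: v)%R <= t%:E * f u + (1 - t)%:E * f v.

Definition proper_convex_lsc f :=
  [/\ proper f, econvex f & lower_semicontinuous f].

Definition coercive f := forall M : R, exists r : R,
  forall u, (r <= `|u|)%R -> M%:E <= f u.

Definition argmin f : set X := [set u | forall v, f u <= f v].

Definition subdifferential f u : set (dual X) :=
  [set w | forall v, f u + (w (v - u)%R)%:E <= f v].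

Definition totally_convex_at f u := forall w, subdifferential f u w ->
  forall v : nat -> X,
    f (v n) - f u - (w (v n - u)%R)%:E @[n --> \oo] --> 0 ->
    `|v n - u|%R @[n --> \oo] --> 0%R.

End ConvexAnalysis.

Section ForwardBackward.
Context (R : realType) (X : normedModType R).

Definition holder_on_ball (Y : normedModType R) (a L r : R) (g : X -> Y) :=
  forall u v, `|u| <= r -> `|v| <= r -> `|g u - g v| <= L * `|u - v| `^ a.

Definition holder_on_bounded (Y : normedModType R) (a : R) (g : X -> Y) :=
  forall r, 0 < r -> exists2 L, 0 < L & holder_on_ball a L r g.

Context (F : X -> R) (dF : X -> dual X) (Phi : X -> \bar R).

Definition objective (u : X) : \bar R := ((F u)%:E + Phi u)%E.

Definition prox_objective (p tau : R) (w : dual X) (u v : X) : \bar R :=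
  ((`|v - u| `^ p / p)%:E + tau%:E * ((w v)%:E + Phi v))%E.

Definition fb_step (p delta tau_min : R) (u u' : X) := exists C L tau : R,
  [/\ 0 < L,
      forall v, (objective v <= objective u)%E -> `|v| <= C,
      holder_on_ball (p - 1) L C dF,
      tau_min <= tau <= p * (1 - delta) / L &
      let S := argmin (prox_objective p tau (dF u) u) in
      S u' /\ forall v, S v -> `|u' - u| <= `|v - u|].

(* The first alternative is the stopping rule: at an optimal iterate no
   parameters have to be chosen and the sequence is continued constantly. *)
Definition fb_sequence (p delta tau_min : R) (u : nat -> X) :=
  (Phi (u 0%N) < +oo)%E /\
  forall n, (argmin objective (u n) /\ u n.+1 = u n) \/
            fb_step p delta tau_min (u n) (u n.+1).

End ForwardBackward.

(* Main.v *)
(* Write J = F + Phi.  Since - F'(u* ) is a subgradient of Phi at u*, convexity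
   of F bounds the Bregman distance of Phi at u* by J(v) - J(u* ), so total
   convexity turns J(u^n) -> J(u* ) into strong convergence, and gives uniqueness
   through constant sequences.  For the values, put
     D_n = Phi(u^n) - Phi(u^(n+1)) + <w^n, u^n - u^(n+1)>.
   Optimality of u^(n+1) against the segment towards u^n gives
   |u^(n+1) - u^n|^p <= tau_n D_n, and with the Hoelder descent lemma
   J(u^(n+1)) <= J(u^n) - delta D_n.  Optimality against the point
   u^n + t (u* - u^n) gives D_n >= t r_n - K t^p, where r_n = J(u^n) - J(u* ).
   As delta D_n <= r_n - r_(n+1) tends to 0, the limit l of r_n satisfies
   l <= K t^(p-1) for every t in ]0, 1], hence l = 0.  *)

Require Import Defs.
From HB Require Import structures.
From mathcomp Require Import all_boot all_order all_algebra.
From mathcomp Require Import all_classical all_reals all_analysis.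
From mathcomp Require Import ring lra.

Set Implicit Arguments.
Unset Strict Implicit.
Unset Printing Implicit Defensive.

Import Order.TTheory GRing.Theory Num.Theory.
Import numFieldNormedType.Exports.

Local Open Scope classical_set_scope.
Local Open Scope ring_scope.

(** * Derivatives compared with one-sided chord slopes *)

Lemma is_derive_ge_chord (R : realType) (f : R -> R) (d c : R) :
  is_derive (0 : R) 1 f d ->
  (forall t, 0 < t -> t <= 1 -> t * c <= f t - f 0) -> c <= d.
Proof.
move=> fd cf.
have fcvg : t^-1 *: (f (t *: 1 + 0) - f 0) @[t --> 0^'+] --> d.
  by apply: cvg_dnbhs_at_right; rewrite -(@derive_val _ _ _ _ _ _ _ fd); exact: ex_derive.
apply: (ler_cvg_to (cvg_cst c) fcvg).
near=> t.
have t0 : 0 < t by [].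
have t1 : t <= 1 by near: t; exact: nbhs_right_le.
have -> : t *: 1 + 0 = t :> R by rewrite addr0 [LHS]mulr1.
by rewrite [leRHS]mulrC ler_pdivlMr // mulrC cf.
Unshelve. all: by end_near. Qed.

Lemma is_derive_le_chord (R : realType) (f : R -> R) (d c : R) :
  is_derive (0 : R) 1 f d ->
  (forall t, 0 < t -> t <= 1 -> f t - f 0 <= t * c) -> d <= c.
Proof.
move=> fd cf; rewrite -lerN2.
apply: (@is_derive_ge_chord _ (- f)) => t t0 t1.
by rewrite mulrN -[- f]/(fun x => - f x)/= -opprD lerN2 cf.
Qed.

(** * Convexity along segments *)

Section Segment.
Context (R : realType) (X : normedModType R).

Lemma line_convE (u v : X) (t : R) :
  u + t *: (v - u) = t *: v + (1 - t) *: u.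
Proof. by rewrite scalerBr scalerBl scale1r addrCA. Qed.

Lemma ler_norm_line (u v : X) (C t : R) :
  0 <= t <= 1 -> `|u| <= C -> `|v| <= C -> `|u + t *: (v - u)| <= C.
Proof.
move=> /andP[t0 t1] uC vC; rewrite line_convE.
apply: (le_trans (ler_normD _ _)).
rewrite !normrZ (ger0_norm t0) ger0_norm ?subr_ge0 //.
by nra.
Qed.

(** Finite end values keep the whole segment in the domain of [Phi], so convexity can be used in
    real arithmetic through [fine]. *)
Lemma econvex_line (Phi : X -> \bar R) u v (t : R) :
  Defs.proper Phi -> econvex Phi -> (Phi u < +oo)%E -> (Phi v < +oo)%E ->
  0 <= t <= 1 -> (Phi (u + t *: (v - u))%R < +oo)%E /\
  fine (Phi (u + t *: (v - u))) <=
    fine (Phi u) + t * (fine (Phi v) - fine (Phi u)).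
Proof.
move=> [Phi_gtNy _] Phi_cvx uoo voo t01.
rewrite line_convE; have := Phi_cvx t v u t01; have := Phi_gtNy (t *: v + (1 - t) *: u).
have := Phi_gtNy u; have := Phi_gtNy v; move: uoo voo.
case: (Phi u) => [a| |] //; case: (Phi v) => [b| |] // _ _ _ _.
case: (Phi _) => [c| |] //= _; rewrite !(lee_fin, EFinM, EFinD) => H.
by split; [exact: ltry|lra].
Qed.

End Segment.

(** * [F] along lines, and the descent estimate *)

Section Line.
Context (R : realType) (X : normedModType R) (F : X -> R) (dF : X -> dual X).
Hypothesis FdF : forall x, is_diff x F (dF x).

Lemma is_derive_line u h (t : R) :
  is_derive t 1 (fun s : R => F (u + s *: h)) (dF (u + t *: h) h).
Proof.
have Fd := FdF (u + t *: h).
have dif : differentiable (F : X -> R^o) (u + t *: h) by exact: ex_diff.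
have E : (fun s : R => s^-1 *: (((fun s : R => F (u + s *: h)) \o shift t) (s *: 1)
   - F (u + t *: h))) =
   (fun s => s^-1 *: ((F \o shift (u + t *: h)) (s *: h) - F (u + t *: h))).
  apply/funext => s /=; congr (_ *: (F _ - _)).
  by rewrite [s *: 1]mulr1 scalerDl addrCA.
have D : 'D_h (F : X -> R^o) (u + t *: h) = dF (u + t *: h) h.
  by rewrite deriveE // diff_val.
apply: DeriveDef; last by rewrite /derive E.
by rewrite /derivable E; apply: (diff_derivable dif).
Qed.

Lemma continuous_line u h : continuous (fun s : R => F (u + s *: h)).
Proof.
by move=> t; apply/differentiable_continuous/derivable1_diffP;
  have [] := is_derive_line u h t.
Qed.

(** Turns inequalities along a segment, from convexity or minimality, into bounds on [dF u]. *)
Lemma diff_ge_chord u h c :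
  (forall t, 0 < t -> t <= 1 -> t * c <= F (u + t *: h) - F u) -> c <= dF u h.
Proof.
move=> cF; have := is_derive_line u h 0; rewrite scale0r addr0 => fd.
by apply: (is_derive_ge_chord fd) => t t0 t1; rewrite scale0r addr0 cF.
Qed.

Lemma diff_le_chord u h c :
  (forall t, 0 < t -> t <= 1 -> F (u + t *: h) - F u <= t * c) -> dF u h <= c.
Proof.
move=> cF; have := is_derive_line u h 0; rewrite scale0r addr0 => fd.
by apply: (is_derive_le_chord fd) => t t0 t1; rewrite scale0r addr0 cF.
Qed.

(** The ball is convex, so the Hoelder bound holds along the whole segment; a monotonicity argument
    replaces the integration of [dF]. *)
Lemma holder_descent p L C u v : 1 < p -> holder_on_ball (p - 1) L C dF ->
  `|u| <= C -> `|v| <= C ->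
  F v <= F u + dF u (v - u) + L / p * `|v - u| `^ p.
Proof.
move=> p1 FL uC vC; have p0 : 0 < p by lra.
set h := v - u; set A := `|h| `^ p.
(* The claim is [g 1 <= g 0]; the last term absorbs the growth of [dF] along the segment and makes
   [g] nonincreasing. *)
pose g t := F (u + t *: h) - dF u h * t - L / p * A * t `^ p.
pose g' t := dF (u + t *: h) h - dF u h - L * A * t `^ (p - 1).
have gd (t : R) : 0 < t -> is_derive t 1 g (g' t).
  move=> t0; rewrite /g /g'.
  have D := is_deriveB (is_deriveB (is_derive_line u h t)
    (is_deriveZ (dF u h) (is_derive_id t (1 : R))))
    (is_deriveZ (L / p * A) (is_derive1_powR p t0)).
  apply: (is_derive_eq D); rewrite [_ *: 1]mulr1; congr (_ - _).
  transitivity (L / p * A * (p * t `^ (p - 1))); first by [].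
  by field; rewrite gt_eqF.
have g'0 t : 0 < t -> t < 1 -> g' t <= 0.
  move=> t0 t1; rewrite /g' subr_le0.
  have -> : dF (u + t *: h) h - dF u h = (dF (u + t *: h) - dF u) h by [].
  apply: (le_trans (ler_norm _)); apply: (le_trans (dual_normP _ _)).
  have utC : `|u + t *: h| <= C by apply: ler_norm_line => //; lra.
  have := FL _ _ utC uC; rewrite addrAC subrr add0r normrZ (gtr0_norm t0) => H.
  apply: (le_trans (ler_wpM2r (normr_ge0 _) H)).
  have -> : A = `|h| * `|h| `^ (p - 1) by rewrite mulr_powRB1.
  rewrite powRM ?(ltW t0) //.
  by rewrite le_eqVlt; apply/orP; left; apply/eqP; ring.
have : g 1 <= g 0.
  apply: (@ler0_derive1_le_cc _ g 0 1) => //; rewrite ?in_itv/= ?lexx ?ler01 //.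
  - by move=> x; rewrite in_itv /= => /andP[x0 x1]; have [] := gd _ x0.
  - move=> x; rewrite in_itv /= => /andP[x0 x1]; rewrite derive1E.
    by rewrite (@derive_val _ _ _ _ _ _ _ (gd _ x0)) g'0.
  - apply/continuous_within_itvP => //; split.
    + move=> x; rewrite in_itv /= => /andP[x0 _].
      by apply/differentiable_continuous/derivable1_diffP; have [] := gd _ x0.
    (* The power rule was used for t > 0 only; at 0, right continuity suffices. *)
    + rewrite /g; apply: cvgB; last first.
        rewrite powR0 ?gt_eqF // mulr0 -[X in _ --> X](mulr0 (L / p * A)).
        by apply: cvgMr; exact: powR_cvg0.
      apply: cvgB; first exact/cvg_at_right_filter/continuous_line.
      by apply: cvgMr; exact/cvg_at_right_filter/cvg_id.
    + apply: cvg_at_left_filter.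
      by apply/differentiable_continuous/derivable1_diffP; have [] := gd _ ltr01.
rewrite /g powR1 powR0 ?gt_eqF // scale0r addr0 scale1r.
have -> : u + h = v by rewrite /h addrCA subrr addr0.
by rewrite !(mulr0, mul0r, mulr1, mul1r, subr0); lra.
Qed.

End Line.

(** * Optimality inequalities for one proximal step *)

Section Prox.
Context (R : realType) (X : normedModType R) (Phi : X -> \bar R).
Context (p tau : R) (w : dual X) (u u' : X).
Hypotheses (Phi_proper : Defs.proper Phi) (Phi_cvx : econvex Phi).
Hypotheses (p1 : 1 < p) (tau0 : 0 < tau) (uoo : (Phi u < +oo)%E).
Hypothesis u'min : argmin (prox_objective Phi p tau w u) u'.

Lemma prox_objectiveE v : (Phi v < +oo)%E ->
  prox_objective Phi p tau w u v =
  (`|v - u| `^ p / p + tau * (w v + fine (Phi v)))%:E.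
Proof.
move=> voo; rewrite /prox_objective.
by have := Phi_proper.1 v; move: voo; case: (Phi v).
Qed.

(** An infinite value at [u'] would lose against the finite one at [u], because [tau] is
    positive. *)
Lemma prox_lty : (Phi u' < +oo)%E.
Proof.
have := u'min u; rewrite (prox_objectiveE uoo) /prox_objective.
have := Phi_proper.1 u'; case: (Phi u') => [a| |] // _.
by rewrite addey // gt0_muley ?lte_fin // addey.
Qed.

Lemma prox_le v : (Phi v < +oo)%E ->
  `|u' - u| `^ p / p + tau * (w u' + fine (Phi u')) <=
  `|v - u| `^ p / p + tau * (w v + fine (Phi v)).
Proof.
by move=> voo; have := u'min v; rewrite !prox_objectiveE ?prox_lty // lee_fin.
Qed.

Let D := fine (Phi u) - fine (Phi u') + w (u - u').

(* Comparing u' with the points of the segment [u', u] and letting them tend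
   to u' gains the factor p lost by a direct comparison with u. *)
Lemma prox_gap_ge_dist : `|u' - u| `^ p <= tau * D.
Proof.
have p0 : 0 < p by exact: lt_trans p1.
set A := `|u' - u| `^ p.
(* On the segment v - u = (1 - t)(u' - u), so this is the distance term of the prox objective. *)
have A'd : is_derive (0 : R) 1 (fun t : R => (A / p) * (1 - t) `^ p) (- A).
  have d1 : is_derive (0 : R) 1 (fun t : R => 1 - t) (-1).
    have := is_deriveB (is_derive_cst (1 : R) (0 : R) (1 : R))
      (is_derive_id (0 : R) (1 : R)).
    by rewrite sub0r.
  have d2 : is_derive (1 - 0 : R) 1 (fun x : R => x `^ p) (p * (1 - 0) `^ (p - 1)).
    by apply: is_derive1_powR; rewrite subr0.
  have D2 := is_deriveZ (A / p) (@is_derive1_comp _ _ (fun t : R => 1 - t) 0 _ _ d2 d1).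
  apply: (is_derive_eq D2); rewrite subr0 powR1.
  transitivity (A / p * (p * 1 * -1)); first by [].
  by field; rewrite gt_eqF.
rewrite -lerN2; apply: (is_derive_ge_chord A'd) => t t0 t1.
rewrite subr0 powR1 mulr1.
have [t01 t0'] : 0 <= t <= 1 /\ 0 <= 1 - t by split; lra.
have [vtoo vt] := econvex_line Phi_proper Phi_cvx prox_lty uoo t01.
have := prox_le vtoo.
have -> : w (u' + t *: (u - u')) = w u' + t * w (u - u').
  by rewrite linearD linearZ.
have -> : u' + t *: (u - u') - u = (1 - t) *: (u' - u).
  by rewrite -[u - u']opprB scalerN scalerBl scale1r addrAC.
rewrite normrZ (ger0_norm t0') powRM // -/A => H.
have := ler_wpM2l (ltW tau0) vt.
rewrite /D; set P := (1 - t) `^ p in H *; set B := w (u - u') in H *.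
by move: H; nra.
Qed.

(** Minimality of [u'] is tested at u + t (v - u). The gain is linear in t and the loss of order
    t^p, so a small t makes the loss negligible. *)
Lemma prox_gap_ge_decrease v t : (Phi v < +oo)%E -> 0 <= t <= 1 ->
  t * (fine (Phi u) - fine (Phi v) + w (u - v)) -
    t `^ p * `|v - u| `^ p / (p * tau) <= D.
Proof.
move=> voo t01; have p0 : 0 < p by exact: lt_trans p1.
have t0 : 0 <= t by case/andP: t01.
have [vtoo vt] := econvex_line Phi_proper Phi_cvx uoo voo t01.
have := prox_le vtoo.
have -> : w (u + t *: (v - u)) = w u + t * w (v - u).
  by rewrite linearD linearZ.
rewrite [u + _ - u]addrAC subrr add0r normrZ (ger0_norm t0) powRM //.
move=> H.
have E : w u' = w u - w (u - u') by rewrite linearB /=; lra.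
have E' : w (v - u) = - w (u - v) by rewrite -linearN /= opprB.
(* This distance term is simply dropped from the smaller side. *)
have A0 : 0 <= `|u' - u| `^ p / p by rewrite divr_ge0 ?powR_ge0 ?ltW.
have H' := ler_wpM2l (ltW tau0) vt.
rewrite -(ler_pM2l tau0) [leLHS]mulrBr /D.
have -> : tau * (t `^ p * `|v - u| `^ p / (p * tau)) = t `^ p * `|v - u| `^ p / p.
  by field; rewrite !gt_eqF.
move: A0 H H'; rewrite E E'.
set x := w (u - u'); set y := w (u - v); set z := w u.
by set c := _ / p; set e := _ / p; lra.
Qed.

End Prox.

(** * Decrease in one step, and total convexity at a minimizer *)

Section Step.
Context (R : realType) (X : normedModType R).
Context (F : X -> R) (dF : X -> dual X) (Phi : X -> \bar R).
Context (p delta tau_min : R).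
Hypothesis FdF : forall x, is_diff x F (dF x).
Hypotheses (F_cvx : econvex (EFin \o F)).
Hypotheses (Phi_proper : Defs.proper Phi) (Phi_cvx : econvex Phi).
Hypotheses (p1 : 1 < p) (delta0 : 0 < delta) (tau_min0 : 0 < tau_min).

Let J v := F v + fine (Phi v).

Lemma objectiveE v : (Phi v < +oo)%E -> objective F Phi v = (J v)%:E.
Proof.
by rewrite /objective /J; have := Phi_proper.1 v; case: (Phi v).
Qed.

Lemma convex_diff_le u v : dF u (v - u) <= F v - F u.
Proof.
apply: (diff_le_chord FdF) => t t0 t1.
rewrite line_convE.
have := F_cvx v u (t := t); rewrite ltW // t1 /= => /(_ isT).
by rewrite -!EFinM -EFinD lee_fin; lra.
Qed.

(** [D] links the decrease of [J] to the gap J u - J v; the parameters [C], [L] and [tau] chosen in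
    the step no longer appear. *)
Lemma fb_step_decrease u u' : (Phi u < +oo)%E ->
  fb_step F dF Phi p delta tau_min u u' ->
  (Phi u' < +oo)%E /\ exists D,
  J u' <= J u - delta * D /\
  forall v t, (Phi v < +oo)%E -> 0 <= t <= 1 ->
    t * (J u - J v) - t `^ p * `|v - u| `^ p / (p * tau_min) <= D.
Proof.
move=> uoo [C] [L] [tau] [L0 JC FL /andP[tau_ge tau_le] [u'min _]].
have p0 : 0 < p by exact: lt_trans p1.
have tau0 : 0 < tau by exact: lt_le_trans tau_ge.
have u'oo := prox_lty Phi_proper tau0 uoo u'min.
split=> //; set w := dF u in u'min.
pose D := fine (Phi u) - fine (Phi u') + w (u - u'); exists D.
have distD : `|u' - u| `^ p <= tau * D.
  exact: prox_gap_ge_dist Phi_proper Phi_cvx p1 tau0 uoo u'min.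
split; last first.
  move=> v t voo t01.
  (* Convexity of [F] replaces its linearization by [J], and [tau_min <= tau] makes the loss
     uniform. *)
  apply: le_trans (prox_gap_ge_decrease Phi_proper Phi_cvx p1 tau0 uoo u'min voo t01).
  have t0 : 0 <= t by case/andP: t01.
  apply: lerB.
    apply: ler_wpM2l => //; have := convex_diff_le u v.
    have -> : dF u (v - u) = - w (u - v) by rewrite -linearN /= opprB.
    by rewrite /J; lra.
  apply: ler_wpM2l; first by rewrite mulr_ge0 ?powR_ge0.
  by rewrite lef_pV2 ?posrE ?mulr_gt0 // ler_pM2l.
have D0 : 0 <= D.
  by rewrite -(pmulr_rge0 _ tau0); apply: le_trans distD; exact: powR_ge0.
set h := u' - u.
have wh : w h = - w (u - u') by rewrite -linearN opprB.
(* [G] replaces [Phi] by its chord: it dominates [J] on the segment, equals [J] at both ends, and is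
   continuous although [Phi] need not be. *)
pose G t := F (u + t *: h) + (fine (Phi u) + t * (fine (Phi u') - fine (Phi u))).
have uh : u + h = u' by rewrite /h addrCA subrr addr0.
have G1 : G 1 = J u' by rewrite /G scale1r mul1r uh /J; lra.
have uC : `|u| <= C by exact: JC.
(* The upper bound on the step size reserves the share delta D for the decrease. *)
have LtD : L / p * (tau * D) <= (1 - delta) * D.
  rewrite mulrA ler_wpM2r //.
  have : L / p * tau <= L / p * (p * (1 - delta) / L).
    by rewrite ler_wpM2l // divr_ge0 // ltW.
  by congr (_ <= _); field; rewrite !gt_eqF.
(* The Hoelder constant is only available in the ball of radius C, so the
   descent estimate along [u, u'] needs G s <= J u beforehand; if this fails at
   s = 1, the intermediate value theorem yields s > 0 with G s = J u, which
   contradicts the estimate at s. *)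
have Gs s : 0 <= s <= 1 -> G s <= J u -> G s <= J u - s * (delta * D).
  move=> s01 GsJ; have [s0 s1] : 0 <= s /\ s <= 1 by case/andP: s01.
  have [soo Phis] := econvex_line Phi_proper Phi_cvx uoo u'oo s01.
  have sC : `|u + s *: h| <= C.
    apply: JC; rewrite !objectiveE // lee_fin; apply: le_trans GsJ.
    by rewrite /J /G lerD2l.
  have := holder_descent FdF p1 FL uC sC.
  rewrite [u + _ - u]addrAC subrr add0r normrZ (ger0_norm s0) powRM // linearZ /=.
  rewrite -/w wh => FsD.
  (* This makes the Hoelder remainder at most linear in s. *)
  have ssp : s `^ p <= s.
    have [->|sn0] := eqVneq s 0; first by rewrite powR0 ?gt_eqF.
    by apply: ge1r_powR; [rewrite lt_def sn0 s0 | exact: ltW].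
  have H1 : L / p * (s `^ p * `|h| `^ p) <= s * ((1 - delta) * D).
    rewrite mulrCA; apply: ler_pM => //; rewrite ?powR_ge0 //.
      by rewrite mulr_ge0 ?powR_ge0 ?divr_ge0 // ltW.
    by apply: le_trans LtD; rewrite ler_wpM2l // divr_ge0 // ltW.
  rewrite /G /J; move: FsD H1; rewrite /D.
  set x := w (u - u'); set y := L / p * _.
  by rewrite -[s *: - x]/(s * - x) => FsD H1; nra.
rewrite -G1; have := Gs 1; rewrite mul1r lexx ler01 /= => /(_ isT); apply.
rewrite leNgt; apply/negP => JG1.
have D_gt0 : 0 < D.
  rewrite lt_def D0 andbT; apply/eqP => D_eq0.
  move: distD; rewrite D_eq0 mulr0 => H.
  have : `|u' - u| `^ p = 0 by apply/eqP; rewrite eq_le H powR_ge0.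
  move/powR_eq0_eq0/normr0_eq0/subr0_eq => E.
  by move: JG1; rewrite G1 E ltxx.
(* The slope of [G] at 0 is -D < 0. Starting at t0 > 0 excludes the crossing at 0, where the
   estimate gives no contradiction. *)
have [t0 [t0_gt0 t0_le1 Gt0]] : exists t, [/\ 0 < t, t <= 1 & G t < J u].
  apply: contrapT => /forallNP nG.
  suff : fine (Phi u) - fine (Phi u') <= w h by rewrite wh; move: D_gt0; rewrite /D; lra.
  apply: (diff_ge_chord FdF) => t t_gt0 t_le1.
  have : J u <= G t by rewrite leNgt; apply/negP => ?; apply: (nG t).
  by rewrite /J /G; lra.
have Gcont : continuous G.
  move=> s; apply: cvgD; first exact: continuous_line.
  by apply: cvgD; [exact: cvg_cst|apply: cvgMl; exact: cvg_id].
have [||s st Gsu] := @IVT _ G t0 1 (J u) t0_le1.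
- exact: continuous_subspaceT.
- by rewrite ge_min le_max (ltW Gt0) (ltW JG1) orbT.
move: st; rewrite in_itv /= => /andP[t0s s1].
have s0 : 0 < s by exact: lt_le_trans t0s.
have := Gs s; rewrite (ltW s0) s1 Gsu lexx => /(_ isT isT).
by have := mulr_gt0 s0 (mulr_gt0 delta0 D_gt0); lra.
Qed.

Lemma argmin_objective_lty ustar : argmin (objective F Phi) ustar ->
  (Phi ustar < +oo)%E.
Proof.
move=> ustar_min; have [v voo] := Phi_proper.2.
have := ustar_min v; rewrite (objectiveE voo) /objective.
by have := Phi_proper.1 ustar; case: (Phi ustar).
Qed.

(** Fermat's rule: minimality along a segment, with [Phi] bounded by its chord, controls the chords
    of [F] from below. *)
Lemma argmin_subdifferential ustar : argmin (objective F Phi) ustar ->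
  subdifferential Phi ustar (- dF ustar).
Proof.
move=> ustar_min v; have ustaroo := argmin_objective_lty ustar_min.
have [voo|] := ltP (Phi v) +oo%E; last by rewrite leye_eq => /eqP->; rewrite leey.
suff : fine (Phi ustar) - fine (Phi v) <= dF ustar (v - ustar).
  change (fine (Phi ustar) - fine (Phi v) <= dF ustar (v - ustar) ->
    (Phi ustar + (- dF ustar (v - ustar)%R)%:E <= Phi v)%E).
  have := Phi_proper.1 v; have := Phi_proper.1 ustar; move: voo ustaroo.
  case: (Phi v) => [a| |] //; case: (Phi ustar) => [b| |] //= _ _ _ _.
  by rewrite lee_fin; lra.
apply: (diff_ge_chord FdF) => t t0 t1.
have t01 : 0 <= t <= 1 by rewrite ltW.
have [too Phit] := econvex_line Phi_proper Phi_cvx ustaroo voo t01.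
have := ustar_min (ustar + t *: (v - ustar)).
by rewrite !objectiveE // lee_fin /J; lra.
Qed.

(** Stated for any sequence, so that it serves both the iterates and the constant sequence at
    another minimizer. *)
Lemma totally_convex_min_cvg ustar (v : nat -> X) :
  argmin (objective F Phi) ustar -> totally_convex_at Phi ustar ->
  (forall n, (Phi (v n) < +oo)%E) ->
  J (v n) @[n --> \oo] --> J ustar -> v @ \oo --> ustar.
Proof.
move=> ustar_min tc voo Jv; have ustaroo := argmin_objective_lty ustar_min.
have sub := argmin_subdifferential ustar_min.
apply/subr_cvg0/norm_cvg0P; apply: (tc _ sub).
(* Bregman distance for the subgradient [- dF ustar], hence the plus sign; it lies between 0 and J(v
   n) - J ustar. *)
pose b n := fine (Phi (v n)) - fine (Phi ustar) + dF ustar (v n - ustar).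
have -> : (fun n => (Phi (v n) - Phi ustar - ((- dF ustar : dual X) (v n - ustar))%:E)%E) =
    EFin \o b.
  apply/funext => n.
  change (Phi (v n) - Phi ustar - (- dF ustar (v n - ustar)%R)%:E = (b n)%:E)%E.
  rewrite /b.
  have := Phi_proper.1 (v n); have := Phi_proper.1 ustar; move: (voo n) ustaroo.
  case: (Phi (v n)) => [a| |] //; case: (Phi ustar) => [c| |] //= _ _ _ _.
  by rewrite -!EFinD opprK.
apply: cvg_EFin; first by near=> n.
apply: (@squeeze_cvgr _ _ _ _ (cst 0) (fun n => J (v n) - J ustar)).
- apply: nearW => n /=; apply/andP; split.
    have : (Phi ustar + (- dF ustar (v n - ustar)%R)%:E <= Phi (v n))%E := sub (v n).
    rewrite /b.
    have := Phi_proper.1 (v n); have := Phi_proper.1 ustar; move: (voo n) ustaroo.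
    case: (Phi (v n)) => [a| |] //; case: (Phi ustar) => [c| |] //= _ _ _ _.
    by rewrite lee_fin; lra.
  by rewrite /b /J; have := convex_diff_le ustar (v n); lra.
- exact: cvg_cst.
- by rewrite -[X in _ --> X](subrr (J ustar)); apply: cvgB => //; exact: cvg_cst.
Unshelve. all: by end_near. Qed.

End Step.

(** * A scalar recursion forcing the objective gaps to 0 *)

Lemma decrease_cvg0 (R : realType) (r : nat -> R) (p delta K : R) :
  1 < p -> 0 < delta -> (forall n, 0 <= r n) ->
  (forall n t, 0 <= t <= 1 -> delta * (t * r n - t `^ p * K) <= r n - r n.+1) ->
  r @ \oo --> 0.
Proof.
move=> p1 delta0 r0 rK.
have p0 : p != 0 by rewrite gt_eqF // (lt_trans _ p1).
(* The choice t = 0 gives monotonicity. *)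
have r_dec : {homo r : n m / (n <= m)%N >-> m <= n}.
  apply/nonincreasing_seqP => n.
  by have := rK n 0; rewrite lexx ler01 powR0 // => /(_ isT); lra.
have r_cvg : cvgn r.
  by apply: nonincreasing_is_cvgn => //; exists 0 => _ [n _ <-].
have r_ge := nonincreasing_cvgn_ge r_dec r_cvg.
set l := limn r in r_ge; have rl : r @ \oo --> l by [].
have l0 : 0 <= l by apply: limr_ge => //; near=> n.
suff l0' : l <= 0 by have <- : l = 0 by apply/eqP; rewrite eq_le l0 l0'.
(* First n tends to infinity with t fixed; only afterwards does t tend to 0. *)
have ltK t : 0 < t -> t <= 1 -> l <= t `^ (p - 1) * K.
  move=> t0 t1; have t01 : 0 <= t <= 1 by rewrite ltW.
  rewrite -(ler_pM2l t0) mulrA mulr_powRB1 ?(ltW t0) ?(lt_trans _ p1) //.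
  rewrite -subr_le0 -(pmulr_rle0 _ delta0).
  have rl0 : r n - l @[n --> \oo] --> (0 : R).
    by rewrite -(subrr l); apply: cvgB => //; exact: cvg_cst.
  apply: (ler_cvg_to (cvg_cst _) rl0); apply: nearW => n.
  apply: (@le_trans _ _ (delta * (t * r n - t `^ p * K))).
    by rewrite ler_pM2l // lerD2r ler_pM2l.
  by apply: le_trans (rK n t t01) _; rewrite lerD2l lerN2.
have tK0 : t `^ (p - 1) * K @[t --> 0^'+] --> 0.
  by rewrite -[X in _ --> X](mul0r K); apply: cvgMl; apply: powR_cvg0; rewrite subr_gt0.
apply: (ler_cvg_to (cvg_cst l) tK0); near=> t; apply: ltK => //.
by near: t; exact: nbhs_right_le.
Unshelve. all: by end_near. Qed.

(** * Uniqueness of the minimizer and strong convergence *)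

Theorem theorem1 (R : realType) (X : completeNormedModType R)
    (F : X -> R) (dF : X -> dual X) (Phi : X -> \bar R)
    (p delta tau_min : R) (u : nat -> X) (ustar : X) :
  reflexive_space X ->
  proper_convex_lsc (EFin \o F) ->
  proper_convex_lsc Phi ->
  coercive (objective F Phi) ->
  1 < p -> p <= 2 ->
  (forall x, is_diff x F (dF x)) ->
  holder_on_bounded (p - 1) dF ->
  0 < delta -> delta < 1 -> 0 < tau_min ->
  fb_sequence F dF Phi p delta tau_min u ->
  argmin (objective F Phi) ustar ->
  totally_convex_at Phi ustar ->
  argmin (objective F Phi) = [set ustar] /\ u @ \oo --> ustar.
Proof.
move=> _ [_ F_cvx _] [Phi_proper Phi_cvx _] coer p1 _ FdF _ delta0 _ tau_min0.
move=> [u0oo ustep] ustar_min tc.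
have p0 : 0 < p by exact: lt_trans p1.
have ustaroo := argmin_objective_lty Phi_proper ustar_min.
have cvg_min := totally_convex_min_cvg FdF F_cvx Phi_proper Phi_cvx ustar_min tc.
pose J v := F v + fine (Phi v).
have JE v : (Phi v < +oo)%E -> objective F Phi v = (J v)%:E.
  exact: objectiveE.
have Jmin v : (Phi v < +oo)%E -> J ustar <= J v.
  by move=> voo; have := ustar_min v; rewrite !JE.
split.
  apply/seteqP; split => [v v_min|_ ->] //=.
  have voo := argmin_objective_lty Phi_proper v_min.
  have : (fun _ : nat => v) @ \oo --> ustar.
    apply: cvg_min => //; change (J v @[_ --> \oo] --> J ustar).
    have -> : J v = J ustar; last exact: cvg_cst.
    apply/eqP; rewrite eq_le Jmin // andbT.
    by have := v_min ustar; rewrite !JE.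
  by move=> /cvg_lim <- //; rewrite lim_cst.
have step n : (Phi (u n) < +oo)%E -> (Phi (u n.+1) < +oo)%E /\
    exists D, J (u n.+1) <= J (u n) - delta * D /\
    forall t, 0 <= t <= 1 -> t * (J (u n) - J ustar)
      - t `^ p * `|ustar - u n| `^ p / (p * tau_min) <= D.
  move=> unoo; have [[un_min ->]|/(fb_step_decrease FdF F_cvx Phi_proper Phi_cvx p1)] := ustep n.
    (* At an optimal iterate the gap vanishes, so D = 0 works. *)
    split=> //; exists 0; rewrite mulr0 subr0; split=> // t _.
    have -> : J (u n) = J ustar.
      by apply/eqP; rewrite eq_le Jmin // andbT; have := un_min ustar; rewrite !JE.
    by rewrite subrr mulr0 sub0r oppr_le0 divr_ge0 ?mulr_ge0 ?powR_ge0 // ltW.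
  move=> /(_ delta0 tau_min0 unoo)[unoo' [D [JD DJ]]]; split=> //.
  by exists D; split=> // t; exact: DJ.
have uoo n : (Phi (u n) < +oo)%E by elim: n => // n /step[].
have Jdec n : J (u n.+1) <= J (u n).
  (* Taking t = 0 shows D >= 0. *)
  have [_ [D [JD /(_ 0)]]] := step n (uoo n).
  rewrite powR0 ?gt_eqF // !mul0r subr0 lexx ler01 => /(_ isT) D0.
  by apply: le_trans JD _; rewrite gerBl mulr_ge0 // ltW.
have Ju0 n : J (u n) <= J (u 0%N).
  by elim: n => // n; apply: le_trans.
(* The extra 1 makes the non-strict bound from coercivity contradict J(u n) <= J(u 0). *)
have [rho rhoP] := coer (J (u 0%N) + 1).
have u_bound n : `|ustar - u n| <= `|ustar| + `|rho|.
  apply: (le_trans (ler_normB _ _)); rewrite lerD2l.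
  rewrite leNgt; apply/negP => /ltW un_ge.
  have := rhoP (u n) (le_trans (ler_norm _) un_ge).
  by rewrite JE // lee_fin; have := Ju0 n; lra.
apply: cvg_min => //; change (J (u n) @[n --> \oo] --> J ustar).
apply/subr_cvg0.
(* Boundedness of the iterates makes the loss constant independent of n; [rho] may be negative,
   hence its absolute value. *)
pose K := (`|ustar| + `|rho|) `^ p / (p * tau_min).
apply: (@decrease_cvg0 _ _ p delta K) => // [n|n t t01].
  by rewrite subr_ge0 Jmin.
have [_ [D [JD /(_ t t01) DJ]]] := step n (uoo n).
apply: (@le_trans _ _ (delta * D)); last by lra.
rewrite ler_pM2l //; apply: le_trans DJ.
rewrite lerB // /K mulrA ler_wpM2r ?invr_ge0 ?mulr_ge0 ?(ltW p0) ?(ltW tau_min0) //.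
by rewrite ler_wpM2l ?powR_ge0 // ge0_ler_powR ?nnegrE ?addr_ge0 ?(ltW p0).
Qed.
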